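(* Let $f:(0,\infty)\to(0,\infty)$ be a continuous increasing function which is regularly varying at infinity with index $1$ (i.e. $f\in \mathrm{RV}_\infty(1)$), and let $\epsilon:(0,\infty)\to\mathbb{R}$ be continuous. Suppose that $f(u)-\epsilon(u)>0$ for all $u>0$, that $\epsilon(u)/f(u)>0$ for all $u>0$, and that $$\lim_{u\to\infty}\frac{\epsilon(u)}{f(u)}=0,\qquad \lim_{u\to\infty}\frac{f(u)}{u}=0.$$ Let $x$ and $y$ be the continuous solutions of $$y'(t)=f(y(t)),\quad t>0,\quad y(0)>0;\qquad x'(t)=f(x(t))-\epsilon(x(t)),\quad t>0,\quad x(0)>0.$$ If there is $\mu\in[0,\infty)$ such that $$\lim_{v\to\infty}\frac{f(v)}{v}\int_0^v\frac{\epsilon(u)}{f^2(u)}\,du=\mu,$$ then $$\lim_{t\to\infty}\frac{x(t)}{y(t)}=e^{-\mu}.$$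
   Context: A measurable function $g:(0,\infty)\to(0,\infty)$ is called regularly varying at infinity with index $\beta\in\mathbb{R}$, written $g\in\mathrm{RV}_\infty(\beta)$, if $g(\lambda t)/g(t)\to\lambda^\beta$ as $t\to\infty$ for every $\lambda>0$. The initial values $x(0)>0$ and $y(0)>0$ are arbitrary and need not be equal. The hypothesis on $\mu$ includes that the integral $\int_0^v \epsilon(u)/f^2(u)\,du$ is finite. Here $f^2(u)=(f(u))^2$. *)

(* Defs.v *)
From HB Require Import structures.
From mathcomp Require Import all_boot all_order all_algebra.
From mathcomp Require Import all_classical all_reals all_analysis.

Set Implicit Arguments.
Unset Strict Implicit.
Unset Printing Implicit Defensive.
Import Order.TTheory GRing.Theory Num.Theory.
Import numFieldNormedType.Exports.
Local Open Scope classical_set_scope.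
Local Open Scope ring_scope.

(* Functions on (0, +oo) are encoded as total functions [R -> R], of which only
   the values at positive arguments are constrained. *)

Definition regularly_varying (R : realType) (beta : R) (g : R -> R) : Prop :=
  [/\ measurable_fun (`]0, +oo[%classic : set R) g,
      (forall t : R, 0 < t -> 0 < g t) &
      forall lambda : R, 0 < lambda ->
        g (lambda * t) / g t @[t --> +oo] --> lambda `^ beta].

(* That [z] stays in the domain (0, +oo) of [g] is not required: when [g] is
   positive on (0, +oo), it follows from the other conditions, so the values
   of [g] outside (0, +oo) play no role. *)
Definition autonomous_solution (R : realType) (g z : R -> R) : Prop :=
  [/\ {within `[0, +oo[, continuous z},
      0 < z 0 &
      forall t : R, 0 < t -> is_derive t 1 z (g (z t))].

(* Main.v *)
Require Import Defs.
From HB Require Import structures.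
From mathcomp Require Import all_boot all_order all_algebra.
From mathcomp Require Import all_classical all_reals all_analysis.
From mathcomp Require Import ring lra.

Set Implicit Arguments.
Unset Strict Implicit.
Unset Printing Implicit Defensive.
Import Order.TTheory GRing.Theory Num.Theory.
Import numFieldNormedType.Exports.
Local Open Scope classical_set_scope.
Local Open Scope ring_scope.

(** Let F be an antiderivative of 1/f.  Along y' = f(y) the quantity F(y) grows
at unit speed, so F(y(t)) - F(x(t)) measures the time lag that eps has caused:
its derivative is (eps/f)(x(t)).

The lag is compared with I(x(t)), where I(v) is the integral of eps/f^2 over
(0, v): with r = (eps/f)(x(t)), the two derivatives are r and r(1 - r), and r
tends to 0 because x tends to infinity.  Antiderivatives of asymptotically
equal functions differ by a relatively small amount plus a constant, and the
weight f(x)/x kills constants, hence f(x)/x * (F(y) - F(x)) tends to mu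
([cvg_weighted_antiderivative]).

It remains to turn a lag into a ratio.  Since f is regularly varying of index
1, f(v)/v * (F(e^s v) - F(v)) tends to s for every real s
([cvg_dilation_increment]): formally it is the integral of f(v)/f(vw) over
1 < w < e^s, whose integrand tends to 1/w.  As F is nondecreasing, comparing
the lag with the cases s = mu - e and s = mu + e squeezes y between
e^(mu - e) x and e^(mu + e) x, so ln(y/x) tends to mu. *)

(** * Mean value theorem on half-lines and antiderivatives *)

Lemma mvt_itvcy (R : realType) (z dz : R -> R) (a s t : R) :
  {within `[a, +oo[, continuous z} ->
  (forall u, a < u -> is_derive u 1 z (dz u)) -> a <= s -> s < t ->
  exists2 c, s < c < t & z t - z s = dz c * (t - s).
Proof.
move=> zc zd as_ st.
have [||c cst ->] := MVT (f := z) (df := dz) st.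
- move=> u; rewrite in_itv/= => /andP[su _]; apply: zd.
  exact: le_lt_trans su.
- apply: continuous_subspaceW zc => u /=; rewrite !in_itv/= => /andP[su _].
  by rewrite (le_trans as_ su).
- by exists c => //; move: cst; rewrite in_itv.
Qed.

Lemma mvt_itvoy (R : realType) (z dz : R -> R) (a s t : R) :
  (forall u, a < u -> is_derive u 1 z (dz u)) -> a < s -> s < t ->
  exists2 c, s < c < t & z t - z s = dz c * (t - s).
Proof.
move=> zd as_ st; apply: (@mvt_itvcy _ _ _ s) => //.
  apply: derivable_within_continuous => u; rewrite in_itv/= andbT => su.
  by have [] := zd _ (lt_le_trans as_ su).
by move=> u su; apply: zd; exact: lt_trans su.
Qed.

Lemma is_derive_Rintegral_itv (R : realType) (h : R -> R) (a u : R) : a < u ->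
  lebesgue_measure.-integrable `]a, u + 1] (EFin \o h) ->
  {for u, continuous h} ->
  is_derive u 1 (fun v => \int[lebesgue_measure]_(t in `]a, v]) h t) (h u).
Proof.
move=> au hi hu.
have uS : u < u + 1 by rewrite ltrDl.
have [||| ? ?] := @continuous_FTC1 R h (BRight a) u _ uS => //.
by apply: DeriveDef => //; rewrite -derive1E.
Qed.

Lemma antiderivative_itvoy (R : realType) (h : R -> R) (c : R) : 0 < c ->
  (forall u, 0 < u -> {for u, continuous h}) ->
  exists H : R -> R, forall u, c < u -> is_derive u 1 H (h u).
Proof.
move=> c0 hc.
exists (fun v => \int[lebesgue_measure]_(t in `]c, v]) h t) => u cu.
apply: is_derive_Rintegral_itv => //; last by apply: hc; exact: lt_trans cu.
have hi : lebesgue_measure.-integrable `[c, u + 1] (EFin \o h).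
  apply: continuous_compact_integrable; first exact: segment_compact.
  apply: continuous_in_subspaceT => v; rewrite inE/= in_itv/= => /andP[cv _].
  by apply: hc; exact: lt_le_trans cv.
apply: integrableS hi => //.
by apply: subset_itvr; rewrite bnd_simp.
Qed.

(** An integrated form of asymptotic equality: |D' - K'| <= e K' beyond T bounds
D - K at t by e (K t - K T) plus its value at T.  After multiplication by w the
terms at T vanish and w K stays near mu, leaving at most about e mu. *)
Lemma cvg_weighted_antiderivative (R : realType)
    (D K d k w : R -> R) (a mu : R) :
  (forall t, a < t -> is_derive t 1 D (d t)) ->
  (forall t, a < t -> is_derive t 1 K (k t)) ->
  (forall e, 0 < e -> \forall t \near +oo, `|d t - k t| <= e * k t) ->
  (\forall t \near +oo, 0 <= w t) -> w t @[t --> +oo] --> 0 ->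
  w t * K t @[t --> +oo] --> mu -> w t * D t @[t --> +oo] --> mu.
Proof.
move=> dD dK dk w0 wl wK.
suff : w t * (D t - K t) @[t --> +oo] --> 0.
  move=> /(cvgD wK); rewrite addr0; apply: cvg_trans; apply: near_eq_cvg.
  by near=> t; rewrite /= -mulrDr addrC subrK.
apply/cvgr0Pnorm_le => e e0.
pose del := e / (`|mu| + 1).
have del0 : 0 < del by rewrite divr_gt0// ltr_wpDl.
have [M [_ dkM]] := dk _ del0.
(* Strictly beyond both thresholds, so that the mean value theorem applies
   from T on. *)
pose T := Num.max a M + 1.
have [aT MT] : a < T /\ M < T.
  by split; rewrite /T -[ltLHS]addr0 ler_ltD// le_max lexx ?orbT.
(* The sign s covers both bounds on D - K at once. *)
have mono s t : (s = 1) \/ (s = -1) -> T < t ->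
    s * ((D t - K t) - (D T - K T)) <= del * (K t - K T).
  move=> s1 Tt.
  pose E := fun t => del * K t - s * (D t - K t).
  pose E' := fun t => del * k t - s * (d t - k t).
  have dE u : a < u -> is_derive u 1 E (E' u).
    move=> au; have := dD _ au; have := dK _ au => ? ?.
    by apply: is_deriveB; apply: is_deriveZ.
  have [r /andP[Tr rt] EE] := mvt_itvoy dE aT Tt.
  suff : 0 <= E t - E T by rewrite /E; lra.
  rewrite EE mulr_ge0 ?subr_ge0 ?(ltW Tt)//.
  rewrite (le_trans (ler_norm _))// normrM.
  have -> : `|s| = 1 by case: s1 => ->; rewrite ?normrN normr1.
  by rewrite mul1r; apply: dkM; exact: lt_trans Tr.
pose C := `|D T - K T| + del * `|K T|.
have : del * (w t * K t) + w t * C @[t --> +oo] --> del * mu + 0 * C.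
  by apply: cvgD; [exact: cvgMl_tmp|exact: cvgMr_tmp].
have delmu : del * mu < e.
  rewrite /del mulrAC ltr_pdivrMr ?ltr_wpDl// ltr_pM2l//.
  by rewrite (le_lt_trans (ler_norm _))// ltrDl.
rewrite mul0r addr0 => /cvgr_lt/(_ e delmu) wC.
apply: filterS3 wC w0 (nbhs_pinfty_gt (num_real T)) => t wC wt Tt.
have := mono 1 t (or_introl erefl) Tt; have := mono (-1) t (or_intror erefl) Tt.
rewrite mulN1r mul1r => h1 h2.
have : `|D t - K t| <= del * K t + C.
  rewrite /C ler_norml.
  have := ler_norm (D T - K T); have := ler_norm (- (D T - K T)).
  have := ler_norm (K T); have := ler_norm (- K T); rewrite !normrN.
  nra.
move=> /(ler_wpM2l wt); rewrite normrM (ger0_norm wt) => /le_trans; apply.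
by rewrite mulrDr (mulrCA _ del) ltW.
Unshelve. all: by end_near. Qed.

(** * Solutions of autonomous equations with positive speed *)

(** A positive speed on (0, +oo) says nothing about g elsewhere, so it has to be
excluded that z leaves the domain: z increases as long as it is positive, hence
cannot reach 0 a first time. *)
Lemma autonomous_solution_gt0 (R : realType) (g z : R -> R) :
  (forall u, 0 < u -> 0 < g u) -> autonomous_solution g z ->
  forall t, 0 <= t -> 0 < z t.
Proof.
move=> g0 [zc z0 zd] T T0; rewrite ltNge; apply/negP => zT.
pose A := [set t | t \in `[0, T]%R /\ z t <= 0].
have cA : compact A.
  apply: (@subclosed_compact _ _ `[0, T]); last 2 first.
  - exact: segment_compact.
  - by move=> t [].
  have zT' : {within `[0, T], continuous z}.
    apply: continuous_subspaceW zc => u /=; rewrite !in_itv/= => /andP[-> _].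
    by [].
  have -> : A = `[0, T] `&` z @^-1` [set u | u <= 0] by [].
  rewrite closed_setSI; last exact: itv_closed.
  by move/continuous_closedP : zT'; apply; exact: closed_le.
(* The first time S at which z is nonpositive contradicts the mean value
   theorem on [0, S], where the slope g (z c) is positive. *)
have [||S] := @compact_EVT_min _ R id A _ cA.
- by exists T; split => //; rewrite in_itv/= T0 lexx.
- by apply: continuous_subspaceT => x; exact: cvg_id.
rewrite inE => -[/=]; rewrite in_itv/= => /andP[S0 ST] zS Smin.
have {}S0 : 0 < S.
  rewrite lt_neqAle S0 andbT; apply/eqP => S0'.
  by move: zS; rewrite -S0' leNgt z0.
have [c /andP[c0 cS] zE] := mvt_itvcy zc zd (lexx 0) S0.
have zc0 : 0 < z c.
  rewrite ltNge; apply/negP => zc0.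
  have /Smin : c \in A.
    by rewrite inE; split => //; rewrite in_itv/= (ltW c0) (le_trans (ltW cS)).
  by rewrite /= leNgt cS.
have : 0 < z S - z 0 by rewrite zE subr0 mulr_gt0// g0.
by rewrite subr_gt0 => /lt_le_trans/(_ zS)/(lt_trans z0); rewrite ltxx.
Qed.

Lemma autonomous_solution_homo (R : realType) (g z : R -> R) :
  (forall u, 0 < u -> 0 < g u) -> autonomous_solution g z ->
  forall s t, 0 <= s -> s <= t -> z s <= z t.
Proof.
move=> g0 zsol s t s0; rewrite le_eqVlt => /predU1P[->//|st].
have zgt0 := autonomous_solution_gt0 g0 zsol; have [zc _ zd] := zsol.
have [c /andP[sc _] zE] := mvt_itvcy zc zd s0 st.
rewrite -subr_ge0 zE mulr_ge0 ?subr_ge0// ltW// g0// zgt0//.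
by rewrite (le_trans s0)// ltW.
Qed.

(** If z stayed below M, its speed would be bounded below by the minimum of g on
the compact interval [z 0, M], and z would outgrow M. *)
Lemma autonomous_solution_cvgy (R : realType) (g z : R -> R) :
  (forall u, 0 < u -> 0 < g u) -> (forall u, 0 < u -> {for u, continuous g}) ->
  autonomous_solution g z -> z t @[t --> +oo] --> +oo.
Proof.
move=> g0 gc zsol; have zh := autonomous_solution_homo g0 zsol.
have [zc z0 zd] := zsol.
apply/cvgryPge => A; pose M := Num.max A (z 0).
have z0M : z 0 <= M by rewrite le_max lexx orbT.
have [|c] := @EVT_min R g _ _ z0M.
  apply: continuous_in_subspaceT => v; rewrite inE/= in_itv/= => /andP[cv _].
  by apply: gc; exact: lt_le_trans cv.
rewrite in_itv/= => /andP[zc0 _] gmin.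
have gc0 : 0 < g c by rewrite g0// (lt_le_trans z0).
(* By then, a speed of at least g c has covered the distance from z 0 to M. *)
have late : \forall t \near +oo, (M - z 0) / g c <= t.
  exact: nbhs_pinfty_ge (num_real _).
near=> t; rewrite leNgt; apply/negP => ztA.
have t0 : 0 < t by [].
have [r /andP[r0 rt] zE] := mvt_itvcy zc zd (lexx 0) t0.
have ztM : z t < M by rewrite (lt_le_trans ztA)// le_max lexx.
have /gmin gr : z r \in `[z 0, M].
  by rewrite in_itv/= zh ?(ltW r0)// (le_trans _ (ltW ztM))// zh// ltW.
have : g c * t <= z t - z 0 by rewrite zE subr0 ler_pM2r.
suff : M - z 0 <= g c * t by lra.
by rewrite mulrC -ler_pdivrMr//.
Unshelve. all: by end_near. Qed.

(** * Antiderivatives of the reciprocal of a regularly varying function *)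

(** Both n (e^(s/n) - 1) and n (1 - e^(-s/n)) tend to s; they are the limits of
the upper and lower sums in [cvg_dilation_increment].  The two bounds are the
same inequality at s and at - s. *)
Lemma expR_scaled_increment (R : realType) (s e : R) : 0 < e ->
  exists2 n : nat, (0 < n)%N &
    n%:R * (expR (s / n%:R) - 1) < s + e /\
    s - e < n%:R * (1 - (expR (s / n%:R))^-1).
Proof.
move=> e0; pose n := (Num.truncn (`|s| + s ^+ 2 / e)).+1.
have nlt : `|s| + s ^+ 2 / e < n%:R := truncnS_gt _.
have n0 : 0 < n%:R :> R by rewrite ltr0n.
have key r : `|r| = `|s| -> n%:R * (expR (r / n%:R) - 1) < r + e.
  move=> rs; have rn : r < n%:R.
    by rewrite (le_lt_trans (ler_norm r))// rs (le_lt_trans _ nlt)// lerDl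
               divr_ge0 ?sqr_ge0// ltW.
  have r2 : r ^+ 2 < e * (n%:R - r).
    rewrite mulrC -ltr_pdivrMr// ltrBrDl (le_lt_trans _ nlt)//.
    rewrite -[r ^+ 2]real_normK ?num_real// rs real_normK ?num_real//.
    by rewrite lerD2r -rs ler_norm.
  rewrite -(@ltr_pM2r _ (n%:R - r)) ?subr_gt0//.
  (* From e^(-u) >= 1 - u at u = r / n: (n - r) e^(r / n) <= n, which bounds
     n (e^(r / n) - 1) by r + r^2 / (n - r). *)
  have : (1 - r / n%:R) * expR (r / n%:R) <= 1.
    rewrite -ler_pdivlMr ?expR_gt0// div1r -expRN; exact: expR_ge1Dx.
  rewrite -(ler_pM2l n0) mulr1 mulrA mulrBr mulr1 mulrCA divff ?gt_eqF// mulr1.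
  set p := expR _ => H.
  have : n%:R * ((n%:R - r) * p) <= n%:R * n%:R :> R by rewrite ler_pM2l.
  nra.
exists n => //; split; first exact: key.
have := key (- s); rewrite normrN => /(_ erefl); rewrite mulNr expRN; lra.
Qed.

Section reciprocal_antiderivative.
Context (R : realType) (f F : R -> R) (c : R).
Hypotheses (c_ge0 : 0 <= c) (f_gt0 : forall u, 0 < u -> 0 < f u)
  (f_homo : forall u v, 0 < u -> u <= v -> f u <= f v)
  (F_derive : forall u, c < u -> is_derive u 1 F (f u)^-1).

(** F is concave, having the nonincreasing derivative 1/f, so its graph lies
below its tangents.  Letting b lie on either side of a gives upper and lower
bounds on increments of F from one inequality. *)
Lemma antiderivative_tangent a b : c < a -> c < b ->
  F b - F a <= (b - a) / f a.
Proof.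
move=> ca cb; have a0 := le_lt_trans c_ge0 ca; have b0 := le_lt_trans c_ge0 cb.
have [ab|ba|<-] := ltgtP a b; last by rewrite !subrr mul0r.
- have [r /andP[ar rb] ->] := mvt_itvoy F_derive ca ab.
  rewrite mulrC ler_wpM2l ?subr_ge0 ?(ltW ab)// lef_pV2 ?posrE ?f_gt0//.
    by rewrite f_homo// ltW.
  exact: lt_trans ar.
- have [r /andP[br ra] FE] := mvt_itvoy F_derive cb ba.
  rewrite -(opprB (F a)) FE -(opprB a) mulNr lerN2 mulrC.
  have r0 : 0 < r by exact: lt_trans br.
  rewrite ler_wpM2r ?subr_ge0 ?(ltW ba)// lef_pV2 ?posrE ?f_gt0//.
  by rewrite f_homo// ltW.
Qed.

Lemma antiderivative_homo a b : c < a -> a <= b -> F a <= F b.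
Proof.
move=> ca ab; have cb := lt_le_trans ca ab.
rewrite -subr_le0 (le_trans (antiderivative_tangent cb ca))//.
by rewrite pmulr_lle0 ?subr_le0// invr_gt0 f_gt0// (le_lt_trans c_ge0).
Qed.

(** Cutting the passage from v to e^s v into n dilations of ratio q = e^(s/n),
the tangents at the two ends of each piece bound the increment of F by
(q - 1) T_i and (1 - 1/q) T_(i+1), where T_i = q^i f(v) / f(q^i v) tends to 1.
So the limit points lie between n (1 - 1/q) and n (q - 1), both close to s for
large n.  Thanks to the monotonicity of f, regular variation at the finitely
many ratios q^i suffices, without uniform convergence. *)
Lemma cvg_dilation_increment :
  (forall l, 0 < l -> f (l * v) / f v @[v --> +oo] --> l) ->
  forall s, f v / v * (F (expR s * v) - F v) @[v --> +oo] --> s.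
Proof.
move=> frv s; apply/cvgrPdist_le => e e0.
have [n n0 [up lo]] := expR_scaled_increment s e0.
set q := expR (s / n%:R) in up lo.
have q0 : 0 < q by exact: expR_gt0.
have qi0 i : 0 < q ^+ i by rewrite exprn_gt0.
have qn : expR s = q ^+ n.
  by rewrite -expRM_natr -mulrA mulVf ?mulr1// pnatr_eq0 -lt0n.
pose T i v := q ^+ i * (f (q ^+ i * v) / f v)^-1.
have T1 i : T i v @[v --> +oo] --> (1 : R).
  rewrite -(@divff _ (q ^+ i)) ?gt_eqF//.
  by apply: cvgMl_tmp; apply: cvgV; [rewrite gt_eqF|exact: frv].
have cvgsum (r : R) j :
    \sum_(0 <= i < n) r * T (i + j)%N v @[v --> +oo] --> n%:R * r.
  have -> : n%:R * r = \sum_(0 <= i < n) r * 1.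
    by rewrite sumr_const_nat subn0 mulr1 mulr_natl.
  by apply: cvg_big => [|i _]; [exact: add_continuous|exact: cvgMl_tmp].
have nearc : \forall v \near +oo, forall i : 'I_n.+1, c < q ^+ i * v.
  apply: filter_forall => i.
  apply: filterS (nbhs_pinfty_gt (num_real (c / q ^+ i))).
  by move=> v; rewrite ltr_pdivrMr// mulrC.
have /cvgr_lt/(_ _ up) Hup := cvgsum (q - 1) 0%N.
have /cvgr_gt/(_ _ lo) Hlo := cvgsum (1 - q^-1) 1%N.
near=> v.
have v0 : 0 < v by [].
have cq i : (i <= n)%N -> c < q ^+ i * v.
  have : forall i : 'I_n.+1, c < q ^+ i * v by near: v.
  by move=> H; rewrite -ltnS => i_n; exact: (H (Ordinal i_n)).
have qv0 i : 0 < q ^+ i * v by rewrite mulr_gt0.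
have w0 : 0 < f v / v by rewrite divr_gt0// f_gt0.
have -> : F (expR s * v) - F v =
    \sum_(0 <= i < n) (F (q ^+ i.+1 * v) - F (q ^+ i * v)).
  by rewrite telescope_sumr// qn expr0 mul1r.
rewrite mulr_sumr.
have ub : \sum_(0 <= i < n) f v / v * (F (q ^+ i.+1 * v) - F (q ^+ i * v)) <=
    \sum_(0 <= i < n) (q - 1) * T (i + 0)%N v.
  apply: ler_sum_nat => i /= i_n; rewrite addn0.
  have := antiderivative_tangent (cq _ (ltnW i_n)) (cq _ i_n).
  move=> /(ler_wpM2l (ltW w0)) => /le_trans; apply; rewrite /T exprS.
  have := f_gt0 (qv0 i); have := f_gt0 v0 => fv fqv.
  by rewrite le_eqVlt; apply/orP; left; apply/eqP; field; rewrite !gt_eqF.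
have lb : \sum_(0 <= i < n) (1 - q^-1) * T (i + 1)%N v <=
    \sum_(0 <= i < n) f v / v * (F (q ^+ i.+1 * v) - F (q ^+ i * v)).
  apply: ler_sum_nat => i /= i_n; rewrite addn1.
  have := antiderivative_tangent (cq _ i_n) (cq _ (ltnW i_n)).
  move=> /(ler_wpM2l (ltW w0)).
  rewrite -(opprB (F (q ^+ i.+1 * v))) mulrN lerNl; apply: le_trans.
  have := f_gt0 (qv0 i.+1); have := f_gt0 v0; rewrite /T exprS => fv fqv.
  by rewrite le_eqVlt; apply/orP; left; apply/eqP; field; rewrite !gt_eqF.
rewrite ler_norml.
have : \sum_(0 <= i < n) (q - 1) * T (i + 0)%N v < s + e by near: v.
have : s - e < \sum_(0 <= i < n) (1 - q^-1) * T (i + 1)%N v by near: v.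
lra.
Unshelve. all: by end_near. Qed.

End reciprocal_antiderivative.

(** * Asymptotic ratio of the perturbed and unperturbed solutions *)

Theorem theorem1 (R : realType) (f eps x y : R -> R) (mu : R)
    (f_gt0 : forall u : R, 0 < u -> 0 < f u)
    (f_cont : {within `]0, +oo[, continuous f})
    (f_incr : {in `]0, +oo[ &, {homo f : u v / u <= v}})
    (f_rv : regularly_varying 1 f)
    (eps_cont : {within `]0, +oo[, continuous eps})
    (f_eps_gt0 : forall u : R, 0 < u -> 0 < f u - eps u)
    (eps_f_gt0 : forall u : R, 0 < u -> 0 < eps u / f u)
    (eps_f_cvg : eps u / f u @[u --> +oo] --> 0)
    (f_sublin : f u / u @[u --> +oo] --> 0)
    (y_sol : autonomous_solution f y)
    (x_sol : autonomous_solution (fun u : R => f u - eps u) x)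
    (mu_ge0 : 0 <= mu)
    (int_fin : forall v : R, 0 < v ->
       lebesgue_measure.-integrable `]0, v[ (fun u => (eps u / f u ^+ 2)%:E))
    (mu_lim : f v / v *
         (\int[lebesgue_measure]_(u in `]0, v[) (eps u / f u ^+ 2))
       @[v --> +oo] --> mu) :
  x t / y t @[t --> +oo] --> expR (- mu).
Proof.
have at_of_within (h : R -> R) : {within `]0, +oo[, continuous h} ->
    forall u : R, 0 < u -> {for u, continuous h}.
  rewrite continuous_open_subspace// => hc u u0.
  by apply: hc; rewrite inE/= in_itv/= u0.
have fc := at_of_within _ f_cont; have ec := at_of_within _ eps_cont.
have fh u v : 0 < u -> u <= v -> f u <= f v.
  move=> u0 uv; apply: f_incr => //; rewrite in_itv/= andbT//.
  exact: lt_le_trans uv.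
have frv l : 0 < l -> f (l * v) / f v @[v --> +oo] --> l.
  by case: f_rv => _ _ + l0 => /(_ l l0); rewrite powRr1// ltW.
have fne u : 0 < u -> f u != 0 by move=> u0; rewrite gt_eqF// f_gt0.
have [_ y0 dy] := y_sol; have [_ x0 dx] := x_sol.
have yh := autonomous_solution_homo f_gt0 y_sol.
have xh := autonomous_solution_homo f_eps_gt0 x_sol.
have xy : x t @[t --> +oo] --> +oo.
  apply: autonomous_solution_cvgy f_eps_gt0 _ x_sol => u u0.
  by apply: cvgB; [exact: fc|exact: ec].
(* A positive base point lying strictly below both trajectories, so that F is
   differentiable at all their points. *)
pose c := Num.min (x 0) (y 0) / 2.
have [c0 cx cy] : [/\ 0 < c, c < x 0 & c < y 0].
  have m0 : 0 < Num.min (x 0) (y 0) by rewrite lt_min x0.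
  have : c < Num.min (x 0) (y 0) by rewrite /c; lra.
  by rewrite lt_min => /andP[-> ->]; split => //; rewrite divr_gt0.
have cxt t : 0 < t -> c < x t.
  by move=> t0; rewrite (lt_le_trans cx)// xh// ltW.
have cyt t : 0 < t -> c < y t.
  by move=> t0; rewrite (lt_le_trans cy)// yh// ltW.
have xt0 t : 0 < t -> 0 < x t by move=> /cxt; exact: lt_trans.
have yt0 t : 0 < t -> 0 < y t by move=> /cyt; exact: lt_trans.
have [F dF] : exists F : R -> R, forall u, c < u -> is_derive u 1 F (f u)^-1.
  apply: antiderivative_itvoy => // u u0.
  by apply: cvgV; [exact: fne|exact: fc].
pose I v := \int[lebesgue_measure]_(u in `]0, v[) (eps u / f u ^+ 2).
have dI (u : R) : 0 < u -> is_derive u 1 I (eps u / f u ^+ 2).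
  move=> u0.
  have int_finc v : 0 < v ->
      lebesgue_measure.-integrable `]0, v] (fun u => (eps u / f u ^+ 2)%:E).
    move=> v0; apply: integrableS (int_fin (v + 1) _) => //;
      last by rewrite addr_gt0.
    by apply: subset_itvl; rewrite bnd_simp ltrDl.
  (* The endpoint v is negligible, which gives the right-closed form that
     [is_derive_Rintegral_itv] differentiates. *)
  have -> : I =
      fun v => \int[lebesgue_measure]_(t in `]0, v]) (eps t / f t ^+ 2).
    apply/funext => v; have [v0|v0] := ltP 0 v.
      by apply: Rintegral_itv_bndo_bndc; exact: int_fin.
    by rewrite /I !set_itv_ge// bnd_simp -leNgt.
  apply: is_derive_Rintegral_itv => //.
    by apply: int_finc; rewrite addr_gt0.
  apply: cvgM; first exact: ec.
  by apply: cvgV; [rewrite expf_neq0// fne|apply: cvgM; exact: fc].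
have dD (t : R) : 0 < t ->
    is_derive t 1 (fun t => F (y t) - F (x t)) (eps (x t) / f (x t)).
  move=> t0; have := dF _ (cyt _ t0); have := dF _ (cxt _ t0) => dFx dFy.
  have := dy _ t0; have := dx _ t0 => dxt dyt.
  have -> : eps (x t) / f (x t) =
      (f (y t))^-1 * f (y t) - (f (x t))^-1 * (f (x t) - eps (x t)).
    by field; rewrite !fne ?xt0 ?yt0.
  by apply: is_deriveB; exact: is_derive1_comp.
have dK (t : R) : 0 < t -> is_derive t 1 (I \o x)
    (eps (x t) / f (x t) ^+ 2 * (f (x t) - eps (x t))).
  move=> t0; have := dI _ (xt0 _ t0); have := dx _ t0 => ? ?.
  exact: is_derive1_comp.
have wD : f (x t) / x t * (F (y t) - F (x t)) @[t --> +oo] --> mu.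
  apply: (cvg_weighted_antiderivative dD dK); last exact: cvg_comp xy mu_lim.
  - move=> e e0.
    have /cvgr_lt/(_ (e / (1 + e))) : eps (x t) / f (x t) @[t --> +oo] --> 0.
      exact: cvg_comp xy eps_f_cvg.
    rewrite divr_gt0 ?addr_gt0// => /(_ isT).
    apply: filterS2 (nbhs_pinfty_gt (num_real 0)) => t t0.
    have := eps_f_gt0 _ (xt0 _ t0); have := f_gt0 _ (xt0 _ t0).
    have -> : eps (x t) / f (x t) ^+ 2 * (f (x t) - eps (x t)) =
        eps (x t) / f (x t) * (1 - eps (x t) / f (x t)).
      by field; rewrite fne ?xt0.
    set r := eps (x t) / f (x t) => _ r0.
    rewrite ltr_pdivlMr ?addr_gt0// => re.
    have -> : r - r * (1 - r) = r * r by ring.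
    have rr : 0 <= r * r by rewrite mulr_ge0// ltW.
    rewrite (ger0_norm rr) (mulrCA e) ler_pM2l//; lra.
  - apply: filterS (nbhs_pinfty_gt (num_real 0)) => t t0.
    by rewrite divr_ge0// ltW ?f_gt0 ?xt0.
  - exact: cvg_comp xy f_sublin.
have dil := cvg_dilation_increment (ltW c0) f_gt0 fh dF frv.
have Fh := antiderivative_homo (ltW c0) f_gt0 fh dF.
(* If y t were not within the bounds, monotonicity of F would put the lag
   on the wrong side of the corresponding dilation increment. *)
have lnyx : ln (y t / x t) @[t --> +oo] --> mu.
  apply/cvgrPdist_le => e e0.
  have up : f (x t) / x t * (F (expR (mu + e) * x t) - F (x t)) -
      f (x t) / x t * (F (y t) - F (x t)) @[t --> +oo] --> mu + e - mu.
    by apply: cvgB wD; exact: cvg_comp xy (dil (mu + e)).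
  have lo : f (x t) / x t * (F (expR (mu - e) * x t) - F (x t)) -
      f (x t) / x t * (F (y t) - F (x t)) @[t --> +oo] --> mu - e - mu.
    by apply: cvgB wD; exact: cvg_comp xy (dil (mu - e)).
  have /cvgr_gt/(_ 0) up' := up; have /cvgr_lt/(_ 0) lo' := lo.
  near=> t.
  have t0 : 0 < t by [].
  have [xt yt] := (xt0 _ t0, yt0 _ t0).
  have w0 : 0 < f (x t) / x t by rewrite divr_gt0// f_gt0.
  have yx0 : 0 < y t / x t by rewrite divr_gt0.
  have ylt : y t < expR (mu + e) * x t.
    rewrite ltNge; apply/negP => H.
    have : 0 < f (x t) / x t * (F (expR (mu + e) * x t) - F (x t)) -
      f (x t) / x t * (F (y t) - F (x t)) by near: t; apply: up'; lra.
    rewrite -mulrBr pmulr_rgt0// subr_gt0 ltrD2r ltNge Fh//.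
    rewrite (lt_le_trans (cxt _ t0))// ler_peMl ?(ltW xt)//.
    by rewrite -expR0 ler_expR addr_ge0// ltW.
  have ygt : expR (mu - e) * x t < y t.
    rewrite ltNge; apply/negP => H.
    have : f (x t) / x t * (F (expR (mu - e) * x t) - F (x t)) -
      f (x t) / x t * (F (y t) - F (x t)) < 0 by near: t; apply: lo'; lra.
    by rewrite -mulrBr pmulr_rlt0// subr_lt0 ltrD2r ltNge Fh// cyt.
  rewrite ler_distlC -(expRK (mu - e)) -(expRK (mu + e)).
  rewrite !ler_ln ?posrE ?expR_gt0// ler_pdivlMr// ler_pdivrMr//.
  by rewrite !ltW.
have : expR (- ln (y t / x t)) @[t --> +oo] --> expR (- mu).
  by apply: continuous_cvg; [exact: continuous_expR|exact: cvgN].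
apply: cvg_trans; apply: near_eq_cvg.
apply: filterS (nbhs_pinfty_gt (num_real 0)) => t t0.
by rewrite expRN lnK ?invf_div// posrE divr_gt0 ?xt0 ?yt0.
Unshelve. all: by end_near. Qed.
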